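(* Let $\mathcal B$ be a Banach space, let $a<b$ be real, and let $Y=Y([a,b],\mathcal B)$ be a Banach space of functions $y:[a,b]\to\mathcal B$ satisfying the $\mathcal V$-condition. Let $\Lambda$ be a metric space, $\lambda_0\in\Lambda$, and for each $\lambda\in\Lambda$ let $F(\cdot,\lambda):Y\to Y$ be a Volterra operator. Consider the equation $$y(t)=(F(y,\lambda))(t),\qquad t\in[a,b]. \qquad ( * )$$ Assume: 1) there is a neighborhood $U_0$ of $\lambda_0$ such that the operators $F(\cdot,\lambda):Y\to Y$, $\lambda\in U_0$, are uniformly locally contracting; 2) for arbitrary $y\in Y$, the mapping $F:Y\times\Lambda\to Y$ is continuous at $(y,\lambda_0)$. Then: (i) For each $\lambda\in U_0$, equation $( * )$ has a unique global or maximally extended solution, and each local solution is a restriction of this solution. (ii) If equation $( * )$ has a global solution $y_0$ at $\lambda=\lambda_0$, then for each $\lambda$ sufficiently close to $\lambda_0$ it also has a global solution $y=y(\lambda)$, and $\|y(\lambda)-y_0\|_Y\to 0$ as $\lambda\to\lambda_0$. (iii) If equation $( * )$ has at $\lambda=\lambda_0$ a maximally extended solution $y_{0\zeta}$ defined on $[a,a+\zeta)$, then for any $\gamma\in(0,\zeta)$ there is a neighborhood of $\lambda_0$ such that for any $\lambda$ in this neighborhood equation $( * )$ has a local solution $y_\gamma=y_\gamma(\lambda)$ defined on $[a,a+\gamma]$, and $\|y_\gamma(\lambda)-y_{0\gamma}\|_{Y_\gamma}\to0$ as $\lambda\to\lambda_0$, where $y_{0\gamma}$ denotes the restriction of $y_{0\zeta}$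 to $[a,a+\gamma]$.
   Context: **$\mathcal V$-condition on $Y$.** For arbitrary $y\in Y$ and $\{y_i\}\subset Y$ with $\|y_i-y\|_Y\to0$, and any $\xi\in(0,b-a)$: if $y_i(t)=0$ on $[a,a+\xi]$ for all $i$, then $y(t)=0$ on $[a,a+\xi]$. **Volterra operator.** $\Psi:Y\to Y$ is a Volterra operator if for any $\xi\in(0,b-a)$ and any $y_1,y_2\in Y$, $y_1(t)=y_2(t)$ on $[a,a+\xi]$ implies $(\Psi y_1)(t)=(\Psi y_2)(t)$ on $[a,a+\xi]$. **Restriction spaces.** For $\xi\in(0,b-a)$, $Y_\xi=Y([a,a+\xi],\mathcal B)$ is the linear space of restrictions $y_\xi$ of functions $y\in Y$ to $[a,a+\xi]$, with norm $\|y_\xi\|_{Y_\xi}=\inf\|y\|_Y$, the infimum being over all extensions $y\in Y$ of $y_\xi$; it is a Banach space. $E_\xi:Y\to Y_\xi$ is the restriction operator $(E_\xi y)(t)=y(t)$, $t\in[a,a+\xi]$ (with $Y_{b-a}=Y$, $E_{b-a}$ the identity). $P_\xi:Y_\xi\to Y$ takes each $y_\xi\in Y_\xi$ to some extension $y\in Y$ of it. For a Volterra operator $\Psi:Y\to Y$ put $\Psi_\xi y_\xi=E_\xi\Psi P_\xi y_\xi$; this operator $\Psi_\xi:Y_\xi\to Y_\xi$ is independent of the choice of extension. **Locally contracting.** A Volterra operator $\Psi:Y\to Y$ is locally contracting if there exists $q<1$ such that for any $r>0$ one can find $\delta>0$ such that for all $y_1,y_2\in Y$ with $\|y_1\|_Y\le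 r$, $\|y_2\|_Y\le r$: ($\mathfrak q_1$) $\|E_\delta\Psi y_1-E_\delta\Psi y_2\|_{Y_\delta}\le q\|E_\delta y_1-E_\delta y_2\|_{Y_\delta}$; ($\mathfrak q_2$) for any $\gamma\in(0,b-a-\delta]$, $E_\gamma y_1=E_\gamma y_2$ implies $\|E_{\gamma+\delta}\Psi y_1-E_{\gamma+\delta}\Psi y_2\|_{Y_{\gamma+\delta}}\le q\|E_{\gamma+\delta}y_1-E_{\gamma+\delta}y_2\|_{Y_{\gamma+\delta}}$. **Uniformly locally contracting.** The family $F(\cdot,\lambda)$, $\lambda\in\Lambda_0\subseteq\Lambda$, is uniformly locally contracting if every $F(\cdot,\lambda)$, $\lambda\in\Lambda_0$, is locally contracting with the same constants: there is $q$ with $0\le q<1$ such that for each $r>0$ there is $\delta>0$ for which ($\mathfrak q_1$) and ($\mathfrak q_2$) hold with $\Psi=F(\cdot,\lambda)$ for every $\lambda\in\Lambda_0$. **Solutions.** Fix $\lambda$, and write $\Psi=F(\cdot,\lambda)$. A local solution of $( * )$ on $[a,a+\gamma]$, $\gamma\in(0,b-a)$, is a function $y_\gamma\in Y_\gamma$ with $\Psi_\gamma y_\gamma=y_\gamma$. A maximally extended solution on $[a,a+\zeta)$, $\zeta\in(0,b-a]$, is a function $y_\zeta:[a,a+\zeta)\to\mathcal B$ whose restriction $y_\gamma$ to $[a,a+\gamma]$ is a local solution for every $\gamma<\zeta$ and $\lim_{\gamma\to\zeta-0}\|y_\gamma\|_{Y_\gamma}=\infty$. A global solution is a function $y\in Y$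 satisfying the equation on all of $[a,b]$. *)

(* Defs.v *)
From HB Require Import structures.
From mathcomp Require Import all_boot all_order all_algebra.
From mathcomp Require Import all_classical all_reals all_analysis.

Set Implicit Arguments.
Unset Strict Implicit.
Unset Printing Implicit Defensive.

Import Order.TTheory GRing.Theory Num.Theory.
Import numFieldNormedType.Exports.

Local Open Scope classical_set_scope.
Local Open Scope ring_scope.

(* A Banach space Y of functions [a, b] -> B is a complete normed space Y with
   an evaluation map ev : Y -> R -> B, of which only the values on [a, b] are
   meaningful.  A function on a subinterval I is encoded as a function R -> B
   that vanishes off I (zero_off I f below), so that Leibniz equality of encodings
   is equality of functions on I. *)

Section VolterraDefs.
Context (R : realType) (B : completeNormedModType R) (a b : R).
Context (Y : completeNormedModType R) (ev : Y -> R -> B).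

Record function_space : Prop := FunctionSpace {
  ev_linear : forall (c : R) (y1 y2 : Y), {in `[a, b], forall t,
    ev (c *: y1 + y2) t = c *: ev y1 t + ev y2 t};
  ev_inj : forall y1 y2 : Y, {in `[a, b], ev y1 =1 ev y2} -> y1 = y2
}.

Definition V_condition : Prop :=
  forall (y : Y) (y_ : nat -> Y), `|y_ i - y| @[i --> \oo] --> (0 : R) ->
  forall xi : R, 0 < xi < b - a ->
  (forall i, {in `[a, a + xi], forall t, ev (y_ i) t = 0}) ->
  {in `[a, a + xi], forall t, ev y t = 0}.

Definition volterra (Psi : Y -> Y) : Prop :=
  forall xi : R, 0 < xi < b - a -> forall y1 y2 : Y,
  {in `[a, a + xi], ev y1 =1 ev y2} ->
  {in `[a, a + xi], ev (Psi y1) =1 ev (Psi y2)}.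

(* The library's restrict pads with point, which need not be 0 in B. *)
Definition zero_off (I : set R) (f : R -> B) : R -> B := patch (fun=> 0) I f.

(* The operator E_xi, for 0 < xi <= b - a; the space Y_xi is its range. *)
Definition Erestr (xi : R) (y : Y) : R -> B := zero_off `[a, a + xi] (ev y).

Definition norm_on (xi : R) (f : R -> B) : R :=
  inf [set `|y| | y in [set y : Y | Erestr xi y = f]].

(* The operator P_xi; the default 0 is used only outside Y_xi. *)
Definition Pext (xi : R) (f : R -> B) : Y := xget 0 [set y : Y | Erestr xi y = f].

Definition restrict_op (Psi : Y -> Y) (xi : R) (f : R -> B) : R -> B :=
  Erestr xi (Psi (Pext xi f)).

Definition q1_condition (Psi : Y -> Y) (q r delta : R) : Prop :=
  forall y1 y2 : Y, `|y1| <= r -> `|y2| <= r ->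
  norm_on delta (Erestr delta (Psi y1) - Erestr delta (Psi y2))
    <= q * norm_on delta (Erestr delta y1 - Erestr delta y2).

Definition q2_condition (Psi : Y -> Y) (q r delta : R) : Prop :=
  forall y1 y2 : Y, `|y1| <= r -> `|y2| <= r ->
  forall gamma : R, 0 < gamma <= b - a - delta -> Erestr gamma y1 = Erestr gamma y2 ->
  norm_on (gamma + delta) (Erestr (gamma + delta) (Psi y1) - Erestr (gamma + delta) (Psi y2))
    <= q * norm_on (gamma + delta) (Erestr (gamma + delta) y1 - Erestr (gamma + delta) y2).

(* delta <= b - a is needed for E_delta to make sense. *)
Definition uniformly_locally_contracting (Lambda : Type)
    (F : Y -> Lambda -> Y) (L0 : set Lambda) : Prop :=
  exists2 q : R, 0 <= q < 1 &
  forall r : R, 0 < r -> exists2 delta : R, 0 < delta <= b - a &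
  forall l, L0 l ->
    q1_condition (F^~ l) q r delta /\ q2_condition (F^~ l) q r delta.

Definition local_solution (Psi : Y -> Y) (gamma : R) (f : R -> B) : Prop :=
  [/\ 0 < gamma < b - a, range (Erestr gamma) f & restrict_op Psi gamma f = f].

Definition maximal_solution (Psi : Y -> Y) (zeta : R) (z : R -> B) : Prop :=
  [/\ 0 < zeta <= b - a,
      z = zero_off `[a, a + zeta[ z,
      forall gamma : R, 0 < gamma < zeta ->
        local_solution Psi gamma (zero_off `[a, a + gamma] z) &
      norm_on gamma (zero_off `[a, a + gamma] z) @[gamma --> zeta^'-] --> +oo].

Definition global_solution (Psi : Y -> Y) (y : Y) : Prop :=
  {in `[a, b], ev y =1 ev (Psi y)}.

Inductive extended_function : Type :=
| Global of Y
| Maximal of R & (R -> B).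

Definition extended_solution (Psi : Y -> Y) (s : extended_function) : Prop :=
  match s with
  | Global y => global_solution Psi y
  | Maximal zeta z => maximal_solution Psi zeta z
  end.

(* f, a function on [a, a + gamma], is a restriction of s. *)
Definition is_restriction (gamma : R) (f : R -> B) (s : extended_function) : Prop :=
  match s with
  | Global y => f = Erestr gamma y
  | Maximal zeta z => gamma < zeta /\ f = zero_off `[a, a + gamma] z
  end.

End VolterraDefs.

(* Main.v *)
Require Import Defs.
From HB Require Import structures.
From mathcomp Require Import all_boot all_order all_algebra.
From mathcomp Require Import all_classical all_reals all_analysis.
From mathcomp Require Import ring lra.

Set Implicit Arguments.
Unset Strict Implicit.
Unset Printing Implicit Defensive.

Import Order.TTheory GRing.Theory Num.Theory.
Import numFieldNormedType.Exports.

Local Open Scope classical_set_scope.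
Local Open Scope ring_scope.


(** Only the times up to which two functions agree matter, so the proof takes
    place in a Banach space Y with a decreasing family of closed subgroups K g:
    the functions that vanish on [a, a + g] when 0 < g, and all of Y when g <= 0.
    The space Y_g is then the quotient Y / K g, but it is never formed; one works
    in Y with the seminorm quot_norm, the distance to K g. A Volterra operator is
    one that respects all congruences modulo K g, a solution on [a, a + g] is a
    y with y - Psi y in K g, and the V-condition says that K g is closed for
    0 < g < b - a; from b - a on, K g is zero.

    In this language both contraction conditions become one (contracts): for x, y
    in the ball of radius r that agree up to g, Psi contracts the seminorm at any
    level h <= g + d; g = 0 imposes no agreement. The conditions are given only
    for steps of length exactly d; they pass to shorter steps since x - y can be
    replaced by an almost norm-minimal representative modulo K h, at the price of
    a larger ball (contracts_of_full_steps).

    The engine is picard_step: a solution u at level g whose residual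
    |Psi u - u| at level h is less than D has a solution v at level h <= g + d
    that extends it, with |v - u| <= D / (1 - q), provided that the ball of radius
    r contains the iterates. Three results follow.

    Uniqueness (solves_unique): d is fixed once the norms of the two solutions are
    bounded, and their difference vanishes at the levels d, 2d, 3d and so on.

    Prolongation (solves_prolong): if there are solutions with bounded norms at
    all levels g < zeta, then one exists beyond zeta, or at the last level. A
    Volterra operator need not map bounded sets to bounded sets, so the residual
    has to be controlled: all solutions agree up to some level g0 close to zeta,
    and from there the contraction condition bounds Psi u by Psi u0 for a
    single u0. Hence at the supremum of the levels of solvability either the last
    level has a solution or the norms are unbounded, and then they tend to
    infinity since they increase with the level (solution_dichotomy).

    Dependence on the parameter (solutions_near): as the same d serves all
    parameters near l0, the given solution y0 is reached in finitely many steps.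
    If u solves the equation for l at level g and is close to y0, then continuity
    of F at (y0, l0) makes the residual of u at level g + d small, because y0 has
    residual zero, and picard_step yields a solution at level g + d close to y0. *)

(** * Filtered Banach spaces and quotient seminorms *)

Section Filtration.
Context (R : realType) (Y : completeNormedModType R) (K : R -> set Y).

Record causal_filtration : Prop := CausalFiltration {
  filt0 : forall g, K g 0;
  filtB : forall g x y, K g x -> K g y -> K g (x - y);
  filt_le : forall g h x, g <= h -> K h x -> K g x;
  filt_start : forall g x, g <= 0 -> K g x;
  filt_lim : forall g (u : nat -> Y) y,
    u @ \oo --> y -> (forall n, K g (u n)) -> K g y
}.

Definition quot_norm (g : R) (y : Y) : R := inf [set `|w| | w in [set w | K g (w - y)]].

Definition causal (Psi : Y -> Y) : Prop :=
  forall g x y, K g (x - y) -> K g (Psi x - Psi y).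

Definition solves (Psi : Y -> Y) (g : R) (y : Y) : Prop := K g (y - Psi y).

(** The levels g <= 0 carry no agreement hypothesis, by [filt_start], so that the
    contraction on the initial segment is the case g = 0. *)
Definition contracts (Psi : Y -> Y) (T q r d : R) : Prop :=
  forall x y g h, `|x| <= r -> `|y| <= r -> 0 < h <= T -> h <= g + d ->
  K g (x - y) -> quot_norm h (Psi x - Psi y) <= q * quot_norm h (x - y).

Hypothesis filtK : causal_filtration.

Lemma filtN g x : K g x -> K g (- x).
Proof. by move=> Kx; rewrite -sub0r; apply: (filtB filtK) => //; apply: (filt0 filtK). Qed.

Lemma filtD g x y : K g x -> K g y -> K g (x + y).
Proof. by move=> Kx /filtN Ky; rewrite -[y]opprK; apply: (filtB filtK). Qed.

Lemma filtBC g x y : K g (x - y) -> K g (y - x).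
Proof. by move/filtN; rewrite opprB. Qed.

Lemma filt_trans g y x z : K g (x - y) -> K g (y - z) -> K g (x - z).
Proof. by move=> h1 h2; have := filtD h1 h2; rewrite addrA subrK. Qed.

Lemma filtxx g x : K g (x - x).
Proof. by rewrite subrr; apply: (filt0 filtK). Qed.

Let quot_lb g y : lbound [set `|w| | w in [set w | K g (w - y)]] 0.
Proof. by move=> _ [w _ <-]. Qed.

Lemma quot_norm_ge0 g y : 0 <= quot_norm g y.
Proof. by apply: lb_le_inf; [exists `|y|, y => //; apply: filtxx|exact: quot_lb]. Qed.

Lemma quot_norm_le_rep g y w : K g (w - y) -> quot_norm g y <= `|w|.
Proof. by move=> Kw; apply: ge_inf; [exists 0; exact: quot_lb|exists w]. Qed.

Lemma quot_norm_le g y : quot_norm g y <= `|y|.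
Proof. by apply: quot_norm_le_rep; apply: filtxx. Qed.

Lemma quot_norm_rep g y D : quot_norm g y < D -> exists2 w, K g (w - y) & `|w| < D.
Proof.
rewrite -subr_gt0 => yD.
have [|e [w Kw <-]] :=
    @inf_adherent R [set `|w| | w in [set w | K g (w - y)]] (D - quot_norm g y) yD.
  by split; [exists `|y|, y => //; apply: filtxx|exists 0; exact: quot_lb].
by rewrite -/(quot_norm g y) subrKC; exists w.
Qed.

Lemma quot_norm_mono g h y : g <= h -> quot_norm g y <= quot_norm h y.
Proof.
move=> gh; apply/ler_addgt0Pr => e e0.
have [|w Kw /ltW] := @quot_norm_rep h y (quot_norm h y + e); first by rewrite ltrDl.
by apply: le_trans; apply: quot_norm_le_rep; apply: (filt_le filtK) gh _.
Qed.

Lemma quot_norm_congr g x y : K g (x - y) -> quot_norm g x = quot_norm g y.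
Proof.
move=> Kxy; congr inf; apply/seteqP; split=> _ [w Kw <-]; exists w => //=.
  exact: filt_trans Kw Kxy.
exact: filt_trans Kw (filtBC Kxy).
Qed.

Lemma quot_normD g x y : quot_norm g (x + y) <= quot_norm g x + quot_norm g y.
Proof.
apply/ler_addgt0Pr => e e0; have e20 : 0 < e / 2 by rewrite divr_gt0.
have [|v Kv vx] := @quot_norm_rep g x (quot_norm g x + e / 2); first by rewrite ltrDl.
have [|w Kw wy] := @quot_norm_rep g y (quot_norm g y + e / 2); first by rewrite ltrDl.
have : quot_norm g (x + y) <= `|v + w|.
  by apply: quot_norm_le_rep; rewrite opprD addrACA; apply: filtD.
have := ler_normD v w; lra.
Qed.

Lemma quot_normN g x : quot_norm g (- x) = quot_norm g x.
Proof.
suff le z : quot_norm g (- z) <= quot_norm g z.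
  by apply/eqP; rewrite eq_le le /= -{1}[x]opprK le.
apply/ler_addgt0Pr => e e0.
have [|w Kw /ltW] := @quot_norm_rep g z (quot_norm g z + e); first by rewrite ltrDl.
rewrite -normrN; apply: le_trans; apply: quot_norm_le_rep.
by rewrite -opprD; apply: filtN.
Qed.

(** This is where closedness enters: representatives of y modulo K g that tend to 0
    exhibit y as a limit of elements of K g. *)
Lemma quot_norm0_mem g y : quot_norm g y <= 0 -> K g y.
Proof.
move=> y0.
have /choice [w Hw] n : exists w, K g (w - y) /\ `|w| < n.+1%:R^-1.
  by have [|w ? ?] := @quot_norm_rep g y n.+1%:R^-1; [exact: le_lt_trans y0 _|exists w].
apply: (filt_lim filtK (u := fun n => y - w n)); last first.
  by move=> n; apply: filtBC; exact: (Hw n).1.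
rewrite -[X in _ --> X]subr0; apply: cvgB; first exact: cvg_cst.
apply/norm_cvg0P; apply: (@squeeze_cvgr _ _ _ R (fun=> 0) harmonic).
- by apply: nearW => n /=; rewrite normr_ge0 ltW //; exact: (Hw n).2.
- exact: cvg_cst.
- exact: cvg_harmonic.
Qed.

Lemma cvg_geometric_steps (v : nat -> Y) (q D : R) : 0 < q < 1 ->
  (forall n, `|v n.+1 - v n| <= D * q ^+ n) ->
  exists2 l, v @ \oo --> l & `|l - v 0%N| <= D / (1 - q).
Proof.
move=> /andP[q0 q1] vD.
have D0 : 0 <= D by have := vD 0%N; rewrite expr0 mulr1; apply: le_trans.
have q1' : 0 < 1 - q by rewrite subr_gt0.
have vE n : v n - v 0%N = series (fun n => v n.+1 - v n) n.
  by rewrite /series /= telescope_sumr.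
have : cvgn (series (fun n => v n.+1 - v n)).
  have geo : cvgn (series (geometric D q)).
    by apply: is_cvg_geometric_series; rewrite gtr0_norm.
  apply: normed_cvg; apply: series_le_cvg geo => n; rewrite /geometric //=.
  by rewrite mulr_ge0 // exprn_ge0 // ltW.
rewrite -(_ : (fun n => v n - v 0%N) = series (fun n => v n.+1 - v n)); last exact/funext.
move=> /cvg_ex [l vl]; exists (l + v 0%N).
  rewrite [X in X @ _](_ : v = (fun n => v n - v 0%N + v 0%N)).
    by apply: (cvgD vl); exact: cvg_cst.
  by apply/funext => n; rewrite subrK.
rewrite addrK; apply: (cvgr_to_le (cvg_norm vl)); apply: nearW => n /=.
have : `|v n - v 0%N| <= D * (1 - q ^+ n) / (1 - q).
  elim: n => [|n IH]; first by rewrite subrr normr0 expr0 subrr mulr0 mul0r.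
  have -> : D * (1 - q ^+ n.+1) / (1 - q) = D * q ^+ n + D * (1 - q ^+ n) / (1 - q).
    by rewrite exprS; field; rewrite gt_eqF.
  rewrite -[v n.+1](subrK (v n)) -addrA.
  by apply: le_trans (ler_normD _ _) _; apply: lerD.
move/le_trans; apply; rewrite ler_pdivlMr // divfK ?gt_eqF //.
by rewrite ler_piMr // gerBl exprn_ge0 // ltW.
Qed.

(** * The step of successive approximation *)

Section Equation.
Variables (Psi : Y -> Y) (T q : R).
Hypothesis causPsi : causal Psi.
Hypothesis q01 : 0 < q < 1.

Lemma solves_le g h y : g <= h -> solves Psi h y -> solves Psi g y.
Proof. exact: (filt_le filtK). Qed.

Lemma solves_congr g x y : K g (x - y) -> solves Psi g x -> solves Psi g y.
Proof.
move=> Kxy Sx; apply: (filt_trans (filtBC Kxy)).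
by apply: (filt_trans Sx); apply: causPsi.
Qed.

(** The iteration runs on representatives in Y: v n.+1 is the representative of
    Psi (v n) modulo K h obtained from v n by an almost minimal correction, so that
    the corrections decrease geometrically in norm although Psi contracts only the
    seminorm. All iterates stay congruent to u modulo K g, which makes the
    contraction condition applicable to them. *)
Lemma picard_step r d u g h D : contracts Psi T q r d -> 0 < h <= T ->
  g <= h <= g + d -> solves Psi g u -> quot_norm h (Psi u - u) < D ->
  `|u| + D / (1 - q) <= r ->
  exists v, [/\ K g (v - u), solves Psi h v & `|v - u| <= D / (1 - q)].
Proof.
move=> con hT /andP[gh hgd] Su uD rD.
have [q0 q1] := andP q01.
have q1' : 0 < 1 - q by rewrite subr_gt0.
have D0 : 0 < D by apply: le_lt_trans uD; exact: quot_norm_ge0.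
(* The invariant; the strict bound on the residual leaves room for the correction. *)
pose I n x := [/\ K g (x - u), `|x - u| <= D * (1 - q ^+ n) / (1 - q)
  & quot_norm h (Psi x - x) < D * q ^+ n].
have Ir n x : I n x -> `|x| <= r.
  move=> [_ xu _]; apply: le_trans rD; rewrite -[x](subrKC u).
  apply: le_trans (ler_normD _ _) _; rewrite lerD2l; apply: le_trans xu _.
  rewrite ler_pdivlMr // divfK ?gt_eqF //.
  by rewrite ler_piMr ?ltW // ltrBlDr ltrDl exprn_gt0.
have step n x : I n x -> exists2 y, I n.+1 y & `|y - x| <= D * q ^+ n.
  move=> Ix; have [xu xn /quot_norm_rep [w Kw wn]] := Ix.
  have Kyx : K h (x + w - Psi x).
    by move: Kw; rewrite opprB addrA [w + x]addrC.
  have yn : `|x + w - u| <= D * (1 - q ^+ n.+1) / (1 - q).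
    have -> : D * (1 - q ^+ n.+1) / (1 - q) = D * (1 - q ^+ n) / (1 - q) + D * q ^+ n.
      by rewrite exprS; field; rewrite gt_eqF.
    by rewrite addrAC; apply: le_trans (ler_normD _ _) _; apply: lerD => //; exact: ltW.
  have Kyu : K g (x + w - u).
    apply: (filt_trans (filt_le filtK gh Kyx)).
    by apply: (filt_trans (causPsi xu)); exact: filtBC.
  have yr : `|x + w| <= r.
    apply: le_trans rD; rewrite -[x + w](subrKC u).
    apply: le_trans (ler_normD _ _) _; rewrite lerD2l; apply: le_trans yn _.
    rewrite ler_pdivlMr // divfK ?gt_eqF //.
    by rewrite ler_piMr ?ltW // ltrBlDr ltrDl exprn_gt0.
  exists (x + w); last by rewrite addrC addKr ltW.
  split=> //.
  have -> : quot_norm h (Psi (x + w) - (x + w)) = quot_norm h (Psi (x + w) - Psi x).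
    by apply: quot_norm_congr; rewrite addrC opprB subrKA; exact: filtBC.
  apply: le_lt_trans (con _ _ g h yr (Ir _ _ Ix) hT hgd _) _.
    by apply: filt_trans Kyu _; exact: filtBC.
  rewrite addrC addKr exprS mulrCA ltr_pM2l //.
  by apply: le_lt_trans wn; exact: quot_norm_le.
(* Dependent choice: the index is carried along to be able to pick successors. *)
have /choice [f Hf] (p : nat * Y) : exists y,
    I p.1 p.2 -> I p.1.+1 y /\ `|y - p.2| <= D * q ^+ p.1.
  have [/step [y Iy yp]|nI] := pselect (I p.1 p.2); first by exists y.
  by exists 0.
pose v := fix v n := if n is m.+1 then f (m, v m) else u.
have Iv n : I n (v n).
  elim: n => [|n IH]; last by have [] := Hf (n, v n) IH.
  by split; rewrite /= ?expr0 ?subrr ?mulr0 ?mul0r ?mulr1 ?normr0 //; exact: (filt0 filtK).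
have [|l vl lD] := cvg_geometric_steps q01 (v := v) (D := D).
  by move=> n; have [] := Hf (n, v n) (Iv n).
have lr : `|l| <= r.
  apply: le_trans rD; rewrite -[l](subrKC u).
  by apply: le_trans (ler_normD _ _) _; rewrite lerD2l.
have Klu : K g (l - u).
  apply: (filt_lim filtK (u := fun n => v n - u)); last by move=> n; case: (Iv n).
  by apply: cvgB => //; exact: cvg_cst.
exists l; split=> //; apply: quot_norm0_mem.
have to0 : `|l - v n| * (1 + q) + D * q ^+ n @[n --> \oo] --> (0 : R).
  rewrite -[X in _ --> X]add0r -[X in _ --> X + _](mul0r (1 + q)).
  apply: cvgD; last by apply: cvg_geometric; rewrite gtr0_norm.
  apply: cvgM; last exact: cvg_cst.
  by apply/norm_cvg0P; rewrite -[X in _ --> X](subrr l); apply: cvgB => //; exact: cvg_cst.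
apply: (cvgr_to_ge to0); apply: nearW => n /=.
have [vu _ vD] := Iv n.
have := con _ _ g h (Ir _ _ (Iv n)) lr hT hgd (filt_trans vu (filtBC Klu)).
have : q * quot_norm h (v n - l) <= q * `|l - v n|.
  by rewrite ler_pM2l // distrC quot_norm_le.
have := quot_norm_le h (l - v n).
have := quot_normD h (l - v n + (v n - Psi (v n))) (Psi (v n) - Psi l).
have := quot_normD h (l - v n) (v n - Psi (v n)).
rewrite -(quot_normN h (v n - Psi (v n))) opprB !subrKA; lra.
Qed.

(** * Uniqueness, prolongation and blow-up *)

Hypothesis Psi_contracts : forall r, 0 < r -> exists2 d, 0 < d & contracts Psi T q r d.

(** Each step uses that on K g-congruent solutions the seminorm of x - y at the next
    level is at most q times itself. *)
Lemma solves_unique h x y : h <= T -> solves Psi h x -> solves Psi h y -> K h (x - y).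
Proof.
move=> hT Sx Sy; have [q0 q1] := andP q01.
have [h0|h0] := leP h 0; first exact: (filt_start filtK).
have [|d d0 con] := Psi_contracts (r := `|x| + `|y| + 1).
  by rewrite ltr_wpDl // addr_ge0.
have steps n : K (Num.min (n%:R * d) h) (x - y).
  elim: n => [|n IH]; first by apply: (filt_start filtK) => //; rewrite mul0r ge_min lexx.
  set k := Num.min _ _.
  have kh : k <= h by rewrite ge_min lexx orbT.
  have k0 : 0 < k by rewrite lt_min h0 mulr_gt0.
  have kn : k <= Num.min (n%:R * d) h + d.
    by rewrite /k -natr1 mulrDl mul1r addr_minl le_min !ge_min lexx lerDl (ltW d0) orbT.
  have xr : `|x| <= `|x| + `|y| + 1 by have := normr_ge0 y; lra.
  have yr : `|y| <= `|x| + `|y| + 1 by have := normr_ge0 x; lra.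
  have kT : 0 < k <= T by rewrite k0 (le_trans kh hT).
  have := con x y _ k xr yr kT kn IH.
  rewrite -(@quot_norm_congr k (x - y)) => [qle|]; last first.
    rewrite opprB [Psi y - _]addrC addrACA [- y + _]addrC -[Psi y - y]opprB.
    by apply: (filtB filtK); [exact: solves_le kh Sx|exact: solves_le kh Sy].
  apply: quot_norm0_mem; rewrite -(@pmulr_rle0 _ (1 - q)) ?subr_gt0 //.
  by rewrite mulrBl mul1r subr_le0.
have hd : h <= (Num.bound (h / d))%:R * d.
  by rewrite -ler_pdivrMr // ltW // archi_boundP // divr_ge0 // ltW.
by have := steps (Num.bound (h / d)); rewrite min_r.
Qed.

(** The length d2 of the decisive step depends on the radius needed for the iteration,
    hence on a bound D of the residual; to find D before d2, a first step length d1
    for the ball of radius M + 1 gives a level g0 from which the residuals of all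
    the solutions are bounded at a level h1 beyond zeta. *)
Lemma solves_prolong M zeta : 0 < zeta <= T ->
  (forall g, 0 < g < zeta -> exists2 u, solves Psi g u & `|u| <= M) ->
  exists h u, solves Psi h u /\ (h = T \/ zeta < h <= T).
Proof.
move=> /andP[z0 zT] sol; have [q0 q1] := andP q01.
have q1' : 0 < 1 - q by rewrite subr_gt0.
have M0 : 0 <= M.
  have [|u _] := sol (zeta / 2); first by apply/andP; split; lra.
  exact: le_trans.
have [|d1 d10 con1] := Psi_contracts (r := M + 1); first by lra.
pose g0 := Num.max (zeta - d1 / 2) (zeta / 2).
have [g00 g0z] : 0 < g0 /\ g0 < zeta.
  by rewrite /g0 lt_max gt_max; split; [apply/orP; right|apply/andP; split]; lra.
have g0d : zeta < g0 + d1.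
  have : zeta - d1 / 2 <= g0 by rewrite le_max lexx.
  lra.
have [|u0 Su0 u0M] := sol g0; first exact/andP.
pose h1 := Num.min (g0 + d1) T.
(* |Psi u - u| <= |Psi u - Psi u0| + |Psi u0| + |u| <= 2 * M + |Psi u0| + M. *)
pose D := 3 * M + `|Psi u0| + 1.
have D0 : 0 < D by have := normr_ge0 (Psi u0); rewrite /D; lra.
have DQ : 0 < D / (1 - q) by rewrite divr_gt0.
have [|d2 d20 con2] := Psi_contracts (r := M + D / (1 - q)); first by lra.
pose g := Num.max g0 (zeta - d2 / 2).
have [g0g gz] : g0 <= g /\ g < zeta.
  by rewrite /g le_max lexx gt_max g0z; split=> //=; lra.
have gd : zeta < g + d2.
  have : zeta - d2 / 2 <= g by rewrite le_max lexx orbT.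
  lra.
have [|u Su uM] := sol g; first by apply/andP; split=> //; exact: lt_le_trans g0g.
have h1T : 0 < h1 <= T.
  by rewrite ge_min lexx orbT lt_min andbT; apply/andP; split; lra.
have Kuu0 : K g0 (u - u0).
  by apply: solves_unique (solves_le g0g Su) Su0; lra.
have bound1 : quot_norm h1 (Psi u - u) < D.
  have h1g : h1 <= g0 + d1 by rewrite ge_min lexx.
  have := con1 u u0 g0 h1 _ _ h1T h1g Kuu0.
  have -> : `|u| <= M + 1 by lra.
  have -> : `|u0| <= M + 1 by lra.
  move=> /(_ isT isT).
  have := quot_norm_ge0 h1 (u - u0).
  have := quot_norm_le h1 (u - u0); have := ler_normB u u0.
  have := quot_normD h1 (Psi u - Psi u0) (Psi u0 - u); rewrite subrKA.
  have := quot_norm_le h1 (Psi u0 - u); have := ler_normB (Psi u0) u.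
  rewrite /D; nra.
pose h := Num.min h1 (g + d2).
have hT : 0 < h <= T.
  rewrite /h /h1 !lt_min !ge_min lexx orbT /=.
  by apply/andP; split; [apply/andP; split; [apply/andP; split|]|]; lra.
have ghd : g <= h <= g + d2.
  rewrite /h /h1 !le_min !ge_min lexx orbT andbT.
  by apply/andP; split; [apply/andP; split|]; lra.
have hh1 : h <= h1 by rewrite ge_min lexx.
have [||v [_ Sv _]] := picard_step con2 hT ghd Su (D := D).
- by apply: le_lt_trans bound1; exact: quot_norm_mono.
- by rewrite lerD2r.
exists h, v; split=> //; rewrite /h /h1.
case: (leP (g0 + d1) T) => ?.
  by case: (leP (g0 + d1) (g + d2)) => ?; right; apply/andP; split; lra.
case: (leP T (g + d2)) => ?; first by left.
by right; apply/andP; split; lra.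
Qed.

(** Unboundedness of the norms suffices for divergence to infinity, as the seminorm
    is monotone in the level. *)
Definition blows_up (zeta : R) : Prop :=
  [/\ 0 < zeta <= T, forall g, 0 < g < zeta -> exists u, solves Psi g u &
      forall M, exists2 g, 0 < g < zeta & forall u, solves Psi g u -> M < quot_norm g u].

Lemma blows_up_unsolvable zeta h u : blows_up zeta -> zeta <= h -> ~ solves Psi h u.
Proof.
move=> [_ _ /(_ `|u|)[g /andP[_ gz] big]] zh Su.
have := big u (solves_le (ltW (lt_le_trans gz zh)) Su).
by rewrite ltNge quot_norm_le.
Qed.

Lemma blows_up_unique z1 z2 : blows_up z1 -> blows_up z2 -> z1 = z2.
Proof.
wlog z12 : z1 z2 / z1 <= z2.
  by move=> W b1 b2; case/orP: (le_total z1 z2) => z; [exact: W|apply/esym/W].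
move=> b1 b2; apply/eqP; rewrite eq_le z12 /= leNgt; apply/negP => zlt.
have [z10 _ _] := b1; have [_ sol _] := b2.
have [|u Su] := sol z1; first by case/andP: z10 => ->.
exact: blows_up_unsolvable b1 (lexx _) Su.
Qed.

(** The blow-up level is the supremum of the levels at which there is a solution; the
    set of these is nonempty by one step from u = 0 at level 0. *)
Lemma solution_dichotomy : 0 < T -> (exists u, solves Psi T u) \/ (exists zeta, blows_up zeta).
Proof.
move=> T0; have [?|nT] := pselect (exists u, solves Psi T u); [by left|right].
have [q0 q1] := andP q01; have q1' : 0 < 1 - q by rewrite subr_gt0.
pose A := [set g | 0 < g <= T /\ exists u, solves Psi g u].
have [g1 Ag1] : exists g, A g.
  pose D := `|Psi 0| + 1; have D0 : 0 < D by rewrite ltr_wpDl.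
  have [|d d0 con] := Psi_contracts (r := D / (1 - q)); first by rewrite divr_gt0.
  have mT : 0 < Num.min d T <= T by rewrite lt_min d0 T0 ge_min lexx orbT.
  have [||||v [_ Sv _]] := picard_step (g := 0) (u := 0) (D := D) con mT.
  - by rewrite add0r ge_min lexx ltW //; case/andP: mT.
  - exact: (filt_start filtK).
  - by apply: le_lt_trans (quot_norm_le _ _) _; rewrite subr0 ltrDl.
  - by rewrite normr0 add0r.
  by exists (Num.min d T); split=> //; exists v.
have supA : has_sup A by split; [exists g1|exists T => g [/andP[]]].
pose zeta := sup A.
have zT : 0 < zeta <= T.
  apply/andP; split; last by apply: ge_sup; [exists g1|move=> g [/andP[]]].
  by have [/andP[g10 _] _] := Ag1; apply: lt_le_trans g10 _; apply: ub_le_sup => //; case: supA.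
have sol g : 0 < g < zeta -> exists u, solves Psi g u.
  move=> /andP[g0 gz].
  have [|h [_ [u Su]] gh] := sup_adherent (E := A) (eps := zeta - g) _ supA.
    by rewrite subr_gt0.
  exists u; apply: solves_le Su; move: gh; rewrite -/zeta subKr; exact: ltW.
exists zeta; split=> // M; apply: contrapT => nbig.
have [|h [u [Su]]] := @solves_prolong (M + 1) zeta zT.
  move=> g gz.
  have [u [Su uM]] : exists u, solves Psi g u /\ quot_norm g u <= M.
    apply: contrapT => nu; apply: nbig; exists g => // u Su.
    by rewrite ltNge; apply/negP => uM; apply: nu; exists u.
  have [|w Kw wM] := @quot_norm_rep g u (M + 1); first by lra.
  by exists w; [apply: solves_congr Su; exact: filtBC|exact: ltW].
move=> [hT|/andP[zh hT]]; first by apply: nT; exists u; rewrite -hT.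
have : h <= zeta.
  apply: ub_le_sup; first by case: supA.
  by split; [rewrite hT andbT; case/andP: zT => z0 _; exact: lt_trans zh|exists u].
by rewrite leNgt zh.
Qed.

(** Let w be a representative of x - y modulo K h of nearly minimal norm. Then x - w
    is congruent to y modulo K h, so it may replace y on the left, and a full step
    applied to x and x - w gives the bound q * |w|. The full step starts at
    g' = min (g, T - d), the largest level not above g from which it fits below T. *)
Lemma contracts_of_full_steps r d : 0 <= r -> 0 < d <= T ->
  (forall x y, `|x| <= 3 * r + 1 -> `|y| <= 3 * r + 1 ->
     quot_norm d (Psi x - Psi y) <= q * quot_norm d (x - y)) ->
  (forall x y g, `|x| <= 3 * r + 1 -> `|y| <= 3 * r + 1 ->
     0 < g <= T - d -> K g (x - y) ->
     quot_norm (g + d) (Psi x - Psi y) <= q * quot_norm (g + d) (x - y)) ->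
  contracts Psi T q r d.
Proof.
move=> r0 /andP[d0 dT] con1 con2 x y g h xr yr /andP[h0 hT] hgd Kxy.
have [q0 q1] := andP q01.
have [gh|/ltW hg] := leP g h; last first.
  have -> : quot_norm h (Psi x - Psi y) = quot_norm h 0.
    by apply: quot_norm_congr; rewrite subr0; apply: causPsi; exact: (filt_le filtK) Kxy.
  apply: le_trans (quot_norm_le _ _) _; rewrite normr0 mulr_ge0 ?quot_norm_ge0 //.
  exact: ltW.
apply/ler_addgt0Pr => e e0.
pose e1 := Num.min e 1.
have [e10 e1e e11] : [/\ 0 < e1, e1 <= e & e1 <= 1].
  by rewrite /e1 lt_min e0 ltr01 !ge_min !lexx orbT.
have [|w Kw wle] := @quot_norm_rep h (x - y) (quot_norm h (x - y) + e1); first by rewrite ltrDl.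
have xyr : quot_norm h (x - y) <= 2 * r.
  by have := quot_norm_le h (x - y); have := ler_normB x y; lra.
have yr' : `|x - w| <= 3 * r + 1 by have := ler_normB x w; lra.
have xr' : `|x| <= 3 * r + 1 by lra.
have Kw' : K h (x - w - y).
  by rewrite addrAC; exact: filtBC.
have -> : quot_norm h (Psi x - Psi y) = quot_norm h (Psi x - Psi (x - w)).
  apply: quot_norm_congr; rewrite opprB addrC subrKA; exact: causPsi.
have wx : x - (x - w) = w by rewrite subKr.
have Kgw : K g (x - (x - w)).
  by rewrite wx -[w](subrK (x - y)); apply: filtD => //; exact: (filt_le filtK) Kw.
suff [k hk con] : exists2 k, h <= k &
    quot_norm k (Psi x - Psi (x - w)) <= q * quot_norm k (x - (x - w)).
  apply: le_trans (quot_norm_mono _ hk) _; apply: le_trans con _.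
  rewrite wx; have := quot_norm_le k w; have := quot_norm_ge0 h (x - y); nra.
pose g' := Num.min g (T - d).
have [g'0|g'0] := leP g' 0.
  exists d; last exact: con1.
  by move: g'0; rewrite ge_min => /orP[]; lra.
have [g'g g'T] : g' <= g /\ g' <= T - d by rewrite !ge_min !lexx orbT.
exists (g' + d); last by apply: con2 => //; [exact/andP|exact: (filt_le filtK) Kgw].
by rewrite addr_minl le_min; apply/andP; split; lra.
Qed.

End Equation.

(** * Continuous dependence on a parameter *)

(** The induction hypothesis is quantified over all tolerances: a step from a solution
    u loses precision twice, through the distance of u to y0 and through F. *)
Lemma solutions_near (L : topologicalType) (l0 : L) (F : Y -> L -> Y) (U0 : set L)
    (T q h e : R) (y0 : Y) :
  0 < q < 1 -> (forall l, causal (F^~ l)) -> nbhs l0 U0 ->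
  (forall r, 0 < r -> exists2 d, 0 < d & forall l, U0 l -> contracts (F^~ l) T q r d) ->
  {for (y0, l0), continuous (fun p : Y * L => F p.1 p.2)} ->
  0 < h <= T -> solves (F^~ l0) h y0 -> 0 < e ->
  \forall l \near l0, exists2 y, solves (F^~ l) h y & `|y - y0| < e.
Proof.
move=> q01 causF U0l0 con cF /andP[h0 hT] S0 e0.
have [q0 q1] := andP q01; have q1' : 0 < 1 - q by rewrite subr_gt0.
have [|d d0 {}con] := con (`|y0| + 2); first by rewrite ltr_wpDl.
have steps n : forall e, 0 < e -> \forall l \near l0,
    exists2 y, solves (F^~ l) (Num.min (n%:R * d) h) y & `|y - y0| < e.
  elim: n => [|n IH] {}e {}e0.
    apply: nearW => l; exists y0; last by rewrite subrr normr0.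
    by apply: (filt_start filtK) => //; rewrite mul0r ge_min lexx.
  set g := Num.min _ _ in IH; set k := Num.min _ _.
  have kh : k <= h by rewrite ge_min lexx orbT.
  have k0 : 0 < k by rewrite lt_min h0 mulr_gt0.
  have gkd : g <= k <= g + d.
    rewrite /g /k -natr1 mulrDl mul1r addr_minl !le_min !ge_min !lexx !orbT /=.
    by rewrite !lerDl (ltW d0) !orbT.
  pose e1 := Num.min e 1; have e10 : 0 < e1 by rewrite lt_min e0 ltr01.
  have [e1e e11] : e1 <= e /\ e1 <= 1 by rewrite !ge_min !lexx orbT.
  (* The step moves u by at most D / (1 - q), half of the tolerance. *)
  pose D := e1 / 2 * (1 - q); have D0 : 0 < D by rewrite mulr_gt0 // divr_gt0.
  have DE : D / (1 - q) = e1 / 2 by rewrite mulfK // gt_eqF.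
  have D1 : D <= e1 / 2 by rewrite ler_piMr ?divr_ge0 ?ltW // gtrBl.
  have /cvgrPdist_lt /(_ (D / 2)) := cF.
  rewrite divr_gt0 // => /(_ isT) [[A B] /= [Ay0 Bl0] AB].
  have /nbhs_ballP [eta /= eta0 etaA] := Ay0.
  have := IH (Num.min eta (D / 2)); rewrite lt_min eta0 divr_gt0 // => /(_ isT).
  move=> near_u; apply: filterS3 U0l0 Bl0 near_u => l Ul Bl [u Su].
  rewrite lt_min => /andP[ueta uD].
  have Fu : `|F y0 l0 - F u l| < D / 2.
    by apply: (AB (u, l)); split=> //=; apply: etaA; rewrite -ball_normE /= distrC.
  have Sk0 : solves (F^~ l0) k y0 by exact: solves_le S0.
  have kT : 0 < k <= T by rewrite k0 (le_trans kh hT).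
  have res : quot_norm k (F u l - u) < D.
    have : quot_norm k (F y0 l0 - u) = quot_norm k (y0 - u).
      by apply: quot_norm_congr; rewrite opprB subrKA; exact: filtBC.
    have := quot_normD k (F u l - F y0 l0) (F y0 l0 - u); rewrite subrKA.
    have := quot_norm_le k (F u l - F y0 l0); have := quot_norm_le k (y0 - u).
    by rewrite distrC [`|F u l - _|]distrC; lra.
  have [|v [_ Sv vu]] := picard_step (causF l) q01 (con l Ul) kT gkd Su res.
    by rewrite DE; have := ler_normD (u - y0) y0; rewrite subrK; lra.
  exists v => //; rewrite DE in vu.
  by have := ler_normD (v - u) (u - y0); rewrite subrKA; lra.
have hd : h <= (Num.bound (h / d))%:R * d.
  by rewrite -ler_pdivrMr // ltW // archi_boundP // divr_ge0 // ltW.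
by have := steps (Num.bound (h / d)) e e0; rewrite min_r.
Qed.

(** By uniqueness any choice of solutions inherits the estimate of the solutions
    found by [solutions_near]. *)
Lemma solution_family (L : topologicalType) (l0 : L) (F : Y -> L -> Y) (U0 : set L)
    (T q h : R) (y0 : Y) :
  0 < q < 1 -> (forall l, causal (F^~ l)) -> nbhs l0 U0 ->
  (forall r, 0 < r -> exists2 d, 0 < d & forall l, U0 l -> contracts (F^~ l) T q r d) ->
  {for (y0, l0), continuous (fun p : Y * L => F p.1 p.2)} ->
  0 < h <= T -> solves (F^~ l0) h y0 ->
  exists y : L -> Y, (\forall l \near l0, solves (F^~ l) h (y l)) /\
    quot_norm h (y l - y0) @[l --> l0] --> (0 : R).
Proof.
move=> q01 causF U0l0 con cF hT S0.
have near_sol e : 0 < e -> \forall l \near l0, exists2 y, solves (F^~ l) h y & `|y - y0| < e.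
  exact: (solutions_near q01 causF U0l0 con cF hT S0).
pose y l := xget 0 [set y | solves (F^~ l) h y].
have yS l x : solves (F^~ l) h x -> solves (F^~ l) h (y l).
  by move=> Sx; apply: (@xgetPex _ 0 [set y | solves (F^~ l) h y]); exists x.
exists y; split.
  by apply: filterS (near_sol 1 ltr01) => l [x /yS].
apply/cvgr0Pnorm_le => e e0; apply: filterS2 U0l0 (near_sol e e0) => l Ul [x Sx xe].
have conl r : 0 < r -> exists2 d, 0 < d & contracts (F^~ l) T q r d.
  by move=> /con [d d0 conU]; exists d => //; exact: conU.
have Kyx : K h (y l - x).
  by apply: (solves_unique q01 conl) (yS l x Sx) Sx; case/andP: hT.
rewrite ger0_norm ?quot_norm_ge0 //.
have -> : quot_norm h (y l - y0) = quot_norm h (x - y0).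
  by apply: quot_norm_congr; rewrite opprB addrA subrK.
exact: le_trans (quot_norm_le _ _) (ltW xe).
Qed.

End Filtration.

(** * The filtration of a function space *)

Section Functions.
Context (R : realType) (B : completeNormedModType R) (a b : R).
Context (Y : completeNormedModType R) (ev : Y -> R -> B).
Hypothesis ab : a < b.
Hypothesis evY : function_space a b ev.
Hypothesis evV : V_condition a b ev.

(** The restriction to [a, b] makes the subgroups trivial from the level b - a on, so
    that solutions at level b - a are global ones. *)
Definition vanishing (g : R) : set Y :=
  [set y | 0 < g -> {in `[a, b], forall t, t <= a + g -> ev y t = 0}].

Lemma evB x y : {in `[a, b], forall t, ev (x - y) t = ev x t - ev y t}.
Proof. by move=> t tab; rewrite addrC -scaleN1r (ev_linear evY) // scaleN1r addrC. Qed.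

Lemma ev0 : {in `[a, b], forall t, ev 0 t = 0}.
Proof. by move=> t tab; rewrite -[X in ev X](subrr 0) evB // subrr. Qed.

Lemma vanishing_full g y : b - a <= g -> vanishing g y -> y = 0.
Proof.
move=> gT vy; apply: (ev_inj evY) => t tab; rewrite ev0 // vy //.
  by rewrite (lt_le_trans _ gT) // subr_gt0.
by move: tab; rewrite in_itv /= => /andP[_]; lra.
Qed.

Lemma quot_norm_full g y : b - a <= g -> quot_norm vanishing g y = `|y|.
Proof.
move=> gT; rewrite /quot_norm (_ : [set `|w| | w in _] = [set `|y|]) ?inf1 //.
apply/seteqP; split=> [_ [w /(vanishing_full gT) /subr0_eq -> <-]|_ ->] //.
by exists y => //= _ t tab _; rewrite subrr ev0.
Qed.

Lemma vanishing_filtration : causal_filtration vanishing.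
Proof.
split.
- by move=> g _ t tab _; rewrite ev0.
- move=> g x y vx vy g0 t tab tg.
  by rewrite evB // vx // vy // subrr.
- move=> g h x gh vx g0 t tab tg; apply: vx => //; last by lra.
  exact: lt_le_trans gh.
- by move=> g x g0 /lt_geF; rewrite g0.
- move=> g u y uy vu g0 t tab tg.
  have [gT|Tg] := ltP g (b - a); last first.
    suff -> : y = 0 by rewrite ev0.
    apply: (cvg_unique _ uy) => //; rewrite (_ : u = fun=> 0); first exact: cvg_cst.
    by apply/funext => n; exact: vanishing_full Tg (vu n).
  have uy0 : `|u i - y| @[i --> \oo] --> (0 : R) by apply/norm_cvg0P/subr_cvg0.
  apply: (evV uy0 (_ : 0 < g < b - a)); first by rewrite g0.
  + move=> n s; rewrite in_itv /= => /andP[as_ sg]; apply: vu => //.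
    by rewrite in_itv /= as_; lra.
  + by move: tab; rewrite !in_itv /= tg => /andP[->].
Qed.
Let filtV := vanishing_filtration.

Lemma ErestrE g y t : Erestr a ev g y t = if a <= t <= a + g then ev y t else 0.
Proof. by rewrite /Erestr /zero_off /patch mem_setE in_itv. Qed.

Lemma Erestr_eqP g x y : 0 < g <= b - a ->
  Erestr a ev g x = Erestr a ev g y <-> vanishing g (x - y).
Proof.
move=> /andP[g0 gT]; split=> [exy _ t tab tg|vxy].
  move/(congr1 (@^~ t)): exy; rewrite !ErestrE tg evB //.
  by move: tab; rewrite in_itv /= => /andP[-> _] /= ->; rewrite subrr.
apply/funext => t; rewrite !ErestrE; case: ifP => // /andP[at_ tg].
have tab : t \in `[a, b] by rewrite in_itv /= at_; lra.
by apply/eqP; rewrite -subr_eq0 -evB // vxy.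
Qed.

Lemma ErestrB g x y : 0 < g <= b - a ->
  Erestr a ev g x - Erestr a ev g y = Erestr a ev g (x - y).
Proof.
move=> /andP[g0 gT]; apply/funext => t; rewrite /= -[LHS]/(_ t - _ t) !ErestrE.
case: ifP => [/andP[at_ tg]|_]; last by rewrite subrr.
by rewrite evB // in_itv /= at_; lra.
Qed.

Lemma norm_on_Erestr g y : 0 < g <= b - a ->
  norm_on a ev g (Erestr a ev g y) = quot_norm vanishing g y.
Proof.
by move=> gT; congr inf; apply/seteqP; split=> _ [w /(Erestr_eqP _ _ gT) Kw <-]; exists w.
Qed.

(** * Local, maximally extended and global solutions *)

Section Operator.
Variable Psi : Y -> Y.
Hypothesis volPsi : volterra a b ev Psi.

Lemma volterra_causal : causal vanishing Psi.
Proof.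
move=> g x y vxy; have [gT|Tg] := ltP g (b - a); last first.
  by rewrite (subr0_eq (vanishing_full Tg vxy)) subrr; exact: filt0 filtV _.
have [g0|g0] := leP g 0; first exact: filt_start filtV _ _ g0.
have gT' : 0 < g <= b - a by rewrite g0 ltW.
have exy : Erestr a ev g x = Erestr a ev g y by apply/Erestr_eqP.
apply/Erestr_eqP => //; apply/funext => t; rewrite !ErestrE; case: ifP => // tg.
apply: (volPsi (xi := g)); rewrite ?g0 ?in_itv //.
move=> s; rewrite in_itv /= => sg.
by move/(congr1 (@^~ s)): exy; rewrite !ErestrE sg.
Qed.

Lemma restrict_op_Erestr g y : 0 < g < b - a ->
  restrict_op a ev Psi g (Erestr a ev g y) = Erestr a ev g (Psi y).
Proof.
move=> /andP[g0 gT]; have gT' : 0 < g <= b - a by rewrite g0 ltW.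
apply/Erestr_eqP => //; apply: volterra_causal; apply/Erestr_eqP => //.
by apply: (@xgetPex _ 0 [set x | Erestr a ev g x = Erestr a ev g y]); exists y.
Qed.

Lemma local_solutionP g f : local_solution a b ev Psi g f <->
  0 < g < b - a /\ exists2 y, f = Erestr a ev g y & solves vanishing Psi g y.
Proof.
have H y : 0 < g < b - a -> solves vanishing Psi g y <->
    restrict_op a ev Psi g (Erestr a ev g y) = Erestr a ev g y.
  move=> gT; rewrite restrict_op_Erestr //.
  have gT' : 0 < g <= b - a by case/andP: gT => -> /ltW.
  by split=> [?|e]; [apply/esym/Erestr_eqP|apply/Erestr_eqP].
by split=> [[gT [y _ <-] /H]|[gT [y -> /H]]] => [/(_ gT) ?|/(_ gT) ?];
  [split=> //; exists y|split=> //; exists y].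
Qed.

Lemma global_solutionP y : global_solution a b ev Psi y <-> solves vanishing Psi (b - a) y.
Proof.
split=> [gy|/(vanishing_full (lexx _)) /subr0_eq yE t _]; last by rewrite -yE.
by rewrite /solves -(ev_inj evY gy) subrr; exact: filt0 filtV _.
Qed.

Variable q : R.
Hypothesis q01 : 0 < q < 1.
Hypothesis conPsi : forall r, 0 < r ->
  exists2 d, 0 < d & contracts vanishing Psi (b - a) q r d.
Let causPsi := volterra_causal.
Let uniqPsi := solves_unique filtV q01 conPsi.

Lemma maximal_solution_piece zeta z g u : maximal_solution a b ev Psi zeta z ->
  0 < g < zeta -> solves vanishing Psi g u -> zero_off `[a, a + g] z = Erestr a ev g u.
Proof.
move=> [/andP[z0 zT] _ loc _] gz Su.
have /local_solutionP [gT [v -> Sv]] := loc g gz.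
have gT' : 0 < g <= b - a by case/andP: gT => -> /ltW.
by apply/Erestr_eqP => //; apply: uniqPsi => //; case/andP: gT'.
Qed.

Lemma maximal_solution_blows_up zeta z :
  maximal_solution a b ev Psi zeta z -> blows_up vanishing Psi (b - a) zeta.
Proof.
move=> mz; have [zT _ loc /cvgryPge big] := mz.
have gT g : 0 < g < zeta -> 0 < g <= b - a.
  by case/andP: zT => _ zT /andP[-> /ltW gz]; exact: le_trans zT.
split=> // [g gz|M].
  by have /local_solutionP [_ [u _ Su]] := loc g gz; exists u.
have z2 : zeta / 2 < zeta by lra.
near zeta^'- => g.
have gz : 0 < g < zeta.
  apply/andP; split; last by near: g; exact: nbhs_left_lt.
  by apply: lt_trans (_ : zeta / 2 < g); [lra|near: g; exact: nbhs_left_gt].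
exists g => // u Su; apply: (@lt_le_trans _ _ (M + 1)); first by rewrite ltrDl.
rewrite -norm_on_Erestr ?gT // -(maximal_solution_piece mz gz Su).
by near: g; exact: big.
Unshelve. all: by end_near. Qed.

Lemma maximal_solution_ext zeta z1 z2 :
  maximal_solution a b ev Psi zeta z1 -> maximal_solution a b ev Psi zeta z2 -> z1 = z2.
Proof.
move=> m1 m2; have [zT -> loc _] := m1; have [_ -> _ _] := m2.
apply/funext => t; rewrite /zero_off /patch mem_setE in_itv /=.
case: ifP => // /andP[at_ tz].
pose g := (t - a + zeta) / 2.
have gz : 0 < g < zeta by apply/andP; rewrite /g; split; lra.
have /local_solutionP [gT [u _ Su]] := loc g gz.
have : zero_off `[a, a + g] z1 = zero_off `[a, a + g] z2.
  by rewrite (maximal_solution_piece m1 gz Su) (maximal_solution_piece m2 gz Su).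
move/(congr1 (@^~ t)); rewrite /zero_off /patch mem_setE in_itv /= at_.
by rewrite (_ : t <= a + g) // /g; lra.
Qed.

(** The solutions at the various levels agree where both are defined; the value of z
    at t is read off the one at the level half way between t - a and zeta. *)
Lemma blows_up_maximal_solution zeta : blows_up vanishing Psi (b - a) zeta ->
  exists z, maximal_solution a b ev Psi zeta z.
Proof.
move=> [zT sol big].
have /choice [u Su] g : exists u, 0 < g < zeta -> solves vanishing Psi g u.
  by have [/sol [v]|] := pselect (0 < g < zeta); [exists v|exists 0].
have gT g : 0 < g < zeta -> 0 < g <= b - a.
  by case/andP: zT => _ zT /andP[-> /ltW gz]; exact: le_trans zT.
pose z := zero_off `[a, a + zeta[ (fun t => ev (u ((t - a + zeta) / 2)) t).
have zE g : 0 < g < zeta -> zero_off `[a, a + g] z = Erestr a ev g (u g).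
  move=> gz; have /andP[g0 gz'] := gz; apply/funext => t; rewrite ErestrE.
  rewrite {1}/zero_off /patch mem_setE in_itv /=; case: ifP => // /andP[at_ tg].
  rewrite /z /zero_off /patch mem_setE in_itv /= at_ (_ : t < a + zeta) /=; last by lra.
  set h := (t - a + zeta) / 2.
  have hz : 0 < h < zeta by apply/andP; rewrite /h; split; lra.
  have th : t <= a + h by rewrite /h; lra.
  have k0 : 0 < Num.min g h by rewrite lt_min g0; case/andP: hz.
  have kT : Num.min g h <= b - a by rewrite ge_min; case/andP: (gT g gz) => _ ->.
  have := uniqPsi kT (solves_le filtV _ (Su h hz)) (solves_le filtV _ (Su g gz)).
  rewrite !ge_min !lexx orbT => /(_ isT isT k0 t).
  have tab : t \in `[a, b] by case/andP: (gT g gz) => _ ?; rewrite in_itv /= at_; lra.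
  by rewrite evB // addr_minr le_min tg th => /(_ tab isT) /subr0_eq.
exists z; split=> //.
- apply/funext => t; rewrite /z /zero_off /patch; case: ifP => //.
- move=> g gz; rewrite zE //; apply/local_solutionP; split; last by exists (u g) => //; exact: Su.
  by case/andP: gz => -> gz /=; case/andP: zT => _; exact: lt_le_trans.
- apply/cvgryPge => M; have [g0 gz0 bigM] := big M.
  have /andP[g00 g0z] := gz0.
  near=> g.
  have g0g : g0 < g by near: g; exact: nbhs_left_gt.
  have gz : 0 < g < zeta.
    by rewrite (lt_trans g00 g0g) /=; near: g; exact: nbhs_left_lt.
  rewrite zE // norm_on_Erestr ?gT // ltW //.
  apply: lt_le_trans (quot_norm_mono filtV _ (ltW g0g)); apply: bigM.
  exact: (solves_le filtV (ltW g0g) (Su g gz)).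
Unshelve. all: by end_near. Qed.

Lemma extended_solution_unique s s' : extended_solution a b ev Psi s ->
  extended_solution a b ev Psi s' -> s' = s.
Proof.
have nomix zeta z y : maximal_solution a b ev Psi zeta z -> ~ global_solution a b ev Psi y.
  move=> /maximal_solution_blows_up bz /global_solutionP.
  have [/andP[_ zT] _ _] := bz.
  exact: (blows_up_unsolvable filtV bz zT).
case: s => [y|zeta z]; case: s' => [y'|zeta' z'] //= sol sol'.
- move/global_solutionP: sol => sol; move/global_solutionP: sol' => sol'.
  by rewrite (subr0_eq (vanishing_full (lexx _) (uniqPsi (lexx _) sol' sol))).
- by case: (nomix _ _ _ sol' sol).
- by case: (nomix _ _ _ sol sol').
- have zz := blows_up_unique filtV (maximal_solution_blows_up sol')
    (maximal_solution_blows_up sol).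
  by subst zeta'; rewrite (maximal_solution_ext sol sol').
Qed.

Lemma extended_solution_exists : exists s, extended_solution a b ev Psi s.
Proof.
have T0 : 0 < b - a by rewrite subr_gt0.
have [[y /global_solutionP gy]|[zeta /blows_up_maximal_solution [z mz]]] :=
  solution_dichotomy filtV causPsi q01 conPsi T0.
  by exists (Global _ y).
by exists (Maximal _ zeta z).
Qed.

Lemma local_solution_restriction s g f : extended_solution a b ev Psi s ->
  local_solution a b ev Psi g f -> is_restriction a ev g f s.
Proof.
move=> es /local_solutionP [gT [u -> Su]].
have gT' : 0 < g <= b - a by case/andP: gT => -> /ltW.
case: s es => [y /global_solutionP Sy|zeta z /= mz] /=.
  apply/Erestr_eqP => //; apply: uniqPsi => //; first by case/andP: gT'.
  by apply: solves_le Sy => //; case/andP: gT'.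
have gz : g < zeta.
  rewrite ltNge; apply/negP => zg.
  exact: (blows_up_unsolvable filtV (maximal_solution_blows_up mz) zg Su).
by rewrite (maximal_solution_piece mz _ Su) // gz andbT; case/andP: gT.
Qed.

End Operator.

(** The factor q0 may be 0, while the geometric estimates of the iteration need a
    positive one; 3 * r + 1 is the radius required by [contracts_of_full_steps]. *)
Lemma uniformly_locally_contracting_contracts (Lambda : Type) (F : Y -> Lambda -> Y)
    (U0 : set Lambda) :
  (forall l, volterra a b ev (F^~ l)) -> uniformly_locally_contracting a b ev F U0 ->
  exists2 q, 0 < q < 1 & forall r, 0 < r -> exists2 d, 0 < d &
    forall l, U0 l -> contracts vanishing (F^~ l) (b - a) q r d.
Proof.
move=> volF [q0 /andP[q00 q01] con].
pose q := (q0 + 1) / 2.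
have qT : 0 < q < 1 by apply/andP; rewrite /q; split; lra.
have q0q : q0 <= q by rewrite /q; lra.
exists q => // r r0.
have [|d /andP[d0 dT] {}con] := con (3 * r + 1); first by lra.
exists d => // l /con [c1 c2].
have dT' : 0 < d <= b - a by rewrite d0.
apply: (contracts_of_full_steps filtV) => //; first exact: volterra_causal.
- exact: ltW.
- move=> x y xr yr; have := c1 x y xr yr; rewrite !ErestrB // !norm_on_Erestr //.
  by move/le_trans; apply; rewrite ler_wpM2r // quot_norm_ge0.
- move=> x y g xr yr gT Kxy.
  have /andP[g0 gd] := gT.
  have gdT : 0 < g + d <= b - a by apply/andP; split; lra.
  have exy : Erestr a ev g x = Erestr a ev g y.
    by apply/Erestr_eqP => //; apply/andP; split; lra.
  have := c2 x y xr yr g gT exy; rewrite !ErestrB // !norm_on_Erestr //.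
  by move/le_trans; apply; rewrite ler_wpM2r // quot_norm_ge0.
Qed.

End Functions.

Theorem theorem2p1 (R : realType) (B : completeNormedModType R) (a b : R)
    (Y : completeNormedModType R) (ev : Y -> R -> B)
    (Lambda : metricType R) (l0 : Lambda) (F : Y -> Lambda -> Y)
    (U0 : set Lambda) :
  a < b ->
  function_space a b ev ->
  V_condition a b ev ->
  (forall l, volterra a b ev (F^~ l)) ->
  nbhs l0 U0 ->
  uniformly_locally_contracting a b ev F U0 ->
  (forall y : Y, {for (y, l0), continuous (fun p : Y * Lambda => F p.1 p.2)}) ->
  [/\ (forall l, U0 l ->
        exists s : extended_function B Y,
          [/\ extended_solution a b ev (F^~ l) s,
              forall s', extended_solution a b ev (F^~ l) s' -> s' = s &
              forall gamma f, local_solution a b ev (F^~ l) gamma f ->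
                is_restriction a ev gamma f s]),
      (forall y0 : Y, global_solution a b ev (F^~ l0) y0 ->
        exists y : Lambda -> Y,
          (\forall l \near l0, global_solution a b ev (F^~ l) (y l)) /\
          `|y l - y0| @[l --> l0] --> (0 : R)) &
      (forall (zeta : R) (z : R -> B),
        maximal_solution a b ev (F^~ l0) zeta z ->
        forall gamma : R, 0 < gamma < zeta ->
        exists y : Lambda -> R -> B,
          (\forall l \near l0, local_solution a b ev (F^~ l) gamma (y l)) /\
          norm_on a ev gamma (y l - zero_off `[a, a + gamma] z) @[l --> l0] --> (0 : R))].
Proof.
move=> ab evY evV volF U0l0 /(uniformly_locally_contracting_contracts ab evY evV volF).
move=> [q q01 con] cF.
have filtV := vanishing_filtration ab evY evV.
have causF l : causal (vanishing a b ev) (F^~ l) by exact: volterra_causal.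
have family h y0 := solution_family (h := h) (y0 := y0) filtV q01 causF U0l0 con (cF y0).
split.
- move=> l Ul.
  have conl r : 0 < r -> exists2 d, 0 < d & contracts (vanishing a b ev) (F^~ l) (b - a) q r d.
    by move=> /con [d d0 conU]; exists d => //; exact: conU.
  have [s es] := extended_solution_exists ab evY evV (volF l) q01 conl.
  exists s; split=> // [s' es'|g f].
    exact: (extended_solution_unique ab evY evV (volF l) q01 conl es es').
  exact: (local_solution_restriction ab evY evV (volF l) q01 conl es).
- move=> y0 /(global_solutionP ab evY evV) S0.
  have [|y [Sy y_y0]] := family (b - a) y0 _ S0; first by rewrite subr_gt0 ab lexx.
  exists y; split.
    by apply: filterS Sy => l Sl; apply/(global_solutionP ab evY evV).
  by under eq_fun do rewrite -(quot_norm_full ab evY _ (lexx (b - a))).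
- move=> zeta z [_ _ loc _] g gz.
  have := loc g gz; move=> /(local_solutionP ab evY evV (volF l0)) [gT [y0 -> S0]].
  have gT' : 0 < g <= b - a by case/andP: gT => -> /ltW.
  have [y [Sy y_y0]] := family g y0 gT' S0.
  exists (fun l => Erestr a ev g (y l)); split.
    apply: filterS Sy => l Sl.
    by apply/(local_solutionP ab evY evV (volF l)); split=> //; exists (y l).
  by under eq_fun do rewrite (ErestrB evY) // (norm_on_Erestr evY) //.
Qed.
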